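(* Let $\mathcal{R}$ be a cubicalizable category with thin-powered structure $\mathcal{R}^+_0$. For each $r\in\mathcal{R}$ regard the Boolean lattice $\mathcal{R}^+_0/r$ as a monoid under the join $\vee$, and let $\mathcal{R}^+_0/(-):\mathcal{V}(\mathcal{R})\to\mathbf{Mon}$ be the functor given on morphisms by $(f\gamma^\dagger)_\ast=f_\ast\gamma^\ast$. Let $\Lambda^\complement:\mathcal{R}^+_0/r\to\mathrm{End}_{\mathcal{V}(\mathcal{R})}(r)$ be the monoid homomorphism $\Lambda^\complement(\xi)=(\neg\xi)(\neg\xi)^\dagger$. Then $\mathcal{R}^+_0/(-)$ together with $\Lambda^\complement$ is a crossed $\mathcal{V}(\mathcal{R})$-module.
   Context: For morphisms $u,v$ of a category, $u\pitchfork v$ means that every commutative square $va=bu$ has a diagonal filler $d$ ($du=a$, $vd=b$). A thin-powered structure on a small category $\mathcal{R}$ is a class $\mathcal{R}^+_0$ of morphisms such that: all its elements are monomorphisms; it is closed under composition; every morphism $f$ factors as $f=\delta\sigma$ with $\delta\in\mathcal{R}^+_0$ and $\sigma\in\mathcal{R}^-:=\{\sigma\mid\sigma\pitchfork\delta'\text{ for all }\delta'\in\mathcal{R}^+_0\}$, and this factorization is strictly unique; write $\mathrm{im}(f)=\delta$. Elements of $\mathcal{R}^+_0$ are called distinguished injections. (It follows that $\mathcal{R}^+_0$ is a wide subcategory whose only isomorphisms are identities, and that each slice category $\mathcal{R}^+_0/r$ is a poset with greatest element $\mathrm{id}_r$, where $\delta_1\le\delta_2$ iff $\delta_1=\delta_2\varepsilon$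 with $\varepsilon\in\mathcal{R}^+_0$.) For $f:r\to r'$ put $f_\ast:\mathcal{R}^+_0/r\to\mathcal{R}^+_0/r'$, $f_\ast(\delta)=\mathrm{im}(f\delta)$. $\mathcal{R}$ is semicomplete if every pair $r'\xrightarrow{f}r\xleftarrow{\delta}s$ with $\delta\in\mathcal{R}^+_0$ has a pullback in $\mathcal{R}$; then there is a unique pullback square in which the projection to $r'$ lies in $\mathcal{R}^+_0$, and this projection is denoted $f^\ast\delta\in\mathcal{R}^+_0/r'$. $\mathcal{R}$ is stable if it is semicomplete and every pullback of a morphism of $\mathcal{R}^-$ along a distinguished injection is in $\mathcal{R}^-$; Boolean if it is semicomplete and every $\mathcal{R}^+_0/r$ is a Boolean lattice (operations $\wedge,\vee,\neg$, least element $0$, greatest element $1$); coherent if it is stable, every $\mathcal{R}^+_0/r$ is a lattice, and for every morphism $f$ the map $f^\ast$ preserves joins and the least element; locally finite if every $\mathcal{R}^+_0/r$ is finite. A small category $\mathcal{R}$ is cubicalizable if it has an initial object $0$ and is equipped with a locally finite, coherent, Boolean thin-powered structure such that for each $r$ the unique morphism $0\to r$ is a distinguished injection. $\mathcal{V}(\mathcal{R})$ is the category with the objects of $\mathcal{R}$ whose morphisms $x\to y$ are spans $x\xleftarrow{\gamma}a\xrightarrow{f}y$ in $\mathcal{R}$ with $\gamma\in\mathcal{R}^+_0$, written $f\gamma^\dagger$; composition: $(g\delta^\dagger)(f\gamma^\dagger)=(gf')(\gamma\delta')^\dagger$, where $\delta'=f^\ast\delta$ and $f'$ is the other projection of the pullback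 of $f$ and $\delta$. For $\gamma:s\to r$ in $\mathcal{R}^+_0$ one has $\gamma^\dagger:r\to s$. A crossed $\mathcal{J}$-module, for a small category $\mathcal{J}$, is a functor $M:\mathcal{J}\to\mathbf{Mon}$ (write $f_\ast=M(f)$) together with monoid homomorphisms $\mu_j:M(j)\to\mathrm{End}_{\mathcal{J}}(j)$ for $j\in\mathcal{J}$ such that for every $f:j\to k$ in $\mathcal{J}$ and $a,b\in M(j)$: (CM1) $\mu_k(f_\ast a)\, f\,\mu_j(a)=\mu_k(f_\ast a)^2 f$; (CM2) $ab=(\mu_j(a)_\ast b)\,a$. *)

(* Defs.v *)
From HB Require Import structures.
From mathcomp Require Import all_boot all_order.
From mathcomp Require Import boolp classical_sets cardinality.

Set Implicit Arguments.
Unset Strict Implicit.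
Unset Printing Implicit Defensive.

Local Open Scope classical_set_scope.

Reserved Notation "g \oc f" (at level 50, left associativity).

Record category := Category {
  obj :> Type;
  hom : obj -> obj -> Type;
  ccomp : forall x y z, hom y z -> hom x y -> hom x z;
  idm : forall x, hom x x;
  comp_assoc : forall x y z w (h : hom z w) (g : hom y z) (f : hom x y),
    ccomp h (ccomp g f) = ccomp (ccomp h g) f;
  comp_idl : forall x y (f : hom x y), ccomp (idm y) f = f;
  comp_idr : forall x y (f : hom x y), ccomp f (idm x) = f
}.

Notation "g \oc f" := (ccomp g f).
Arguments idm {c} x.

Section Category.
Variable C : category.

Definition monic x y (f : @hom C x y) :=
  forall z (g h : @hom C z x), f \oc g = f \oc h -> g = h.

Definition lifts a b x y (u : @hom C a b) (v : @hom C x y) :=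
  forall (s : hom a x) (t : hom b y), v \oc s = t \oc u ->
  exists d : hom b x, d \oc u = s /\ v \oc d = t.

Definition is_pullback x y z p (f : @hom C x z) (g : @hom C y z)
    (p1 : @hom C p x) (p2 : @hom C p y) :=
  f \oc p1 = g \oc p2 /\
  forall q (a : hom q x) (b : hom q y), f \oc a = g \oc b ->
  exists! h : hom q p, p1 \oc h = a /\ p2 \oc h = b.

Definition morphism_class := forall x y : C, hom x y -> Prop.

(* The class R^- of the morphisms that are left orthogonal to D. *)
Definition minus_class (D : morphism_class) x y (s : @hom C x y) :=
  forall a b (d : hom a b), D a b d -> lifts s d.

Record factorization (D : morphism_class) x y (f : @hom C x y) :=
  Factorization {
    fac_mid : C;
    fac_inj : hom fac_mid y;
    fac_proj : hom x fac_mid;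
    fac_injP : D _ _ fac_inj;
    fac_projP : minus_class D fac_proj;
    facE : f = fac_inj \oc fac_proj
  }.

(* Closure under composition is understood to include the empty composite,
   i.e. the identities: on the groupoid with exactly one morphism between any
   two of its objects a, r, the class {id_a, a -> r} satisfies all the other
   axioms, but it is not a wide subcategory.
   Strict uniqueness: the middle object, and not only its isomorphism class, is
   determined. *)
Record thin_powered := ThinPowered {
  dist : morphism_class;
  dist_monic : forall x y (d : hom x y), dist d -> monic d;
  dist_id : forall x, dist (idm x);
  dist_comp : forall x y z (d : hom y z) (e : hom x y),
    dist d -> dist e -> dist (d \oc e);
  dist_fact : forall x y (f : hom x y), exists! F : factorization dist f, True
}.

End Category.

Section Sub.
Variables (C : category) (T : thin_powered C).

(* The elements of R^+_0 / r. *)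
Record sub (r : C) := DistSub {
  dom : C;
  arr : hom dom r;
  arrP : dist T arr
}.

HB.instance Definition _ r := gen_eqMixin (sub r).
HB.instance Definition _ r := gen_choiceMixin (sub r).

Definition subLe r (d1 d2 : sub r) : Prop :=
  exists e : hom (dom d1) (dom d2), dist T e /\ arr d1 = arr d2 \oc e.

(* An isomorphism between elements of R^+_0 / r is an identity. *)
Lemma sub_iso_ind r (d1 d2 : sub r) (h : hom (dom d1) (dom d2))
    (k : hom (dom d2) (dom d1)) :
  arr d1 = arr d2 \oc h -> arr d2 = arr d1 \oc k ->
  forall P : forall d : sub r, hom (dom d1) (dom d) -> Prop,
  P d1 (idm _) -> P d2 h.
Proof.
move=> eh ek P.
have hk : h \oc k = idm _.
  by apply: (dist_monic (arrP d2)); rewrite comp_assoc -eh -ek comp_idr.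
have kh : k \oc h = idm _.
  by apply: (dist_monic (arrP d1)); rewrite comp_assoc -ek -eh comp_idr.
have isom_minus a b (u : @hom C a b) v :
    u \oc v = idm _ -> v \oc u = idm _ -> minus_class (@dist _ T) u.
  move=> uv vu p q d _ s t E; exists (s \oc v); split.
    by rewrite -comp_assoc vu comp_idr.
  by rewrite comp_assoc E -comp_assoc uv comp_idr.
have [F [_ Fu]] := dist_fact T (arr d1).
have m1 := isom_minus _ _ _ _ (comp_idl (idm (dom d1))) (comp_idl _).
have E1 := Fu (Factorization (arrP d1) m1 (esym (comp_idr (arr d1)))) I.
have E2 := Fu (Factorization (arrP d2) (isom_minus _ _ _ _ hk kh) eh) I.
have eta (d : sub r) : d = DistSub (arrP d) by case: d.
pose Q (G : factorization (@dist _ T) (arr d1)) :=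
  P (DistSub (fac_injP G)) (fac_proj G).
move=> Pid.
have : Q F by rewrite E1 /Q /=; case: (d1) P Pid {Q F E1 E2 Fu m1 h k eh ek hk kh}.
by rewrite E2 /Q /=; case: (d2) h {k eh ek hk kh E2}.
Qed.

Lemma subLe_refl r (d : sub r) : subLe d d.
Proof. by exists (idm _); rewrite comp_idr; split=> //; apply: dist_id. Qed.

Lemma subLe_trans r (d2 d1 d3 : sub r) : subLe d1 d2 -> subLe d2 d3 -> subLe d1 d3.
Proof.
move=> [e [De E]] [f [Df F]]; exists (f \oc e).
by rewrite comp_assoc -F; split=> //; apply: dist_comp.
Qed.

Lemma subLe_anti r (d1 d2 : sub r) : subLe d1 d2 -> subLe d2 d1 -> d1 = d2.
Proof.
move=> [e [_ E]] [f [_ F]].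
exact: (sub_iso_ind E F (P := fun d _ => d1 = d)).
Qed.

Fact sub_display : Order.disp_t. Proof. exact: Order.Disp tt tt. Qed.

Fact sub_le_refl r : reflexive (fun d1 d2 : sub r => `[< subLe d1 d2 >]).
Proof. by move=> d; apply/asboolP/subLe_refl. Qed.
Fact sub_le_anti r : antisymmetric (fun d1 d2 : sub r => `[< subLe d1 d2 >]).
Proof. by move=> d1 d2 /andP[/asboolP h /asboolP k]; apply: subLe_anti. Qed.
Fact sub_le_trans r : transitive (fun d1 d2 : sub r => `[< subLe d1 d2 >]).
Proof.
by move=> d2 d1 d3 /asboolP h /asboolP k; apply/asboolP; apply: subLe_trans k.
Qed.

HB.instance Definition _ r := Order.Le_isPOrder.Build sub_display (sub r)
  (@sub_le_refl r) (@sub_le_anti r) (@sub_le_trans r).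

Lemma sub_leP r (d1 d2 : sub r) : reflect (subLe d1 d2) (d1 <= d2)%O.
Proof. exact: asboolP. Qed.

Definition im_fact x y (f : hom x y) : factorization (@dist _ T) f :=
  projT1 (cid (dist_fact T f)).

Definition im x y (f : hom x y) : sub y := DistSub (fac_injP (im_fact f)).

(* f_* *)
Definition dimage x y (f : hom x y) (d : sub x) : sub y := im (f \oc arr d).

Definition semicomplete := forall x y (f : hom x y) (d : sub y),
  exists p (p1 : hom p x) (p2 : hom p (dom d)), is_pullback f (arr d) p1 p2.

(* The pullback squares of a distinguished injection in which the opposite
   projection is distinguished; there is exactly one of them. *)
Record dist_pullback x y (f : hom x y) (d : sub y) := DistPullback {
  dpb_sub : sub x;
  dpb_top : hom (dom dpb_sub) (dom d);
  dpbP : is_pullback f (arr d) (arr dpb_sub) dpb_top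
}.

Lemma dist_pullback_ex (sc : semicomplete) x y (f : hom x y) (d : sub y) :
  exists P : dist_pullback f d, True.
Proof.
have [p [p1 [p2 [E U]]]] := sc x y f d.
have [[m i s Di Ds e] _] := dist_fact T p1.
have [t [ts dt]] : exists t : hom m (dom d), t \oc s = p2 /\ arr d \oc t = f \oc i.
  by apply: (Ds _ _ _ (arrP d)); rewrite -E e comp_assoc.
have [h [[h1 h2] _]] := U m i t (esym dt).
have sh : s \oc h = idm _.
  by apply: (dist_monic Di); rewrite comp_assoc -e h1 comp_idr.
unshelve eexists (@DistPullback _ _ f d (DistSub Di) t _); split=> //= q a b ab.
have [k [[ka kb] ku]] := U q a b ab.
exists (s \oc k); split.
  by rewrite !comp_assoc -e ts.
move=> l [la lb]; rewrite (ku (h \oc l)).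
  by rewrite comp_assoc sh comp_idl.
by rewrite !comp_assoc h1 h2.
Qed.

Lemma dist_pullback_uniq x y (f : hom x y) (d : sub y) (P Q : dist_pullback f d) :
  P = Q.
Proof.
case: P Q => [a s hP] [b t hQ].
have [k [[k1 k2] _]] := hQ.2 _ _ _ hP.1.
have [l [[l1 l2] _]] := hP.2 _ _ _ hQ.1.
move: (t) (hQ) k2.
apply: (sub_iso_ind (esym k1) (esym l1) (P := fun b k => forall t
  (hQ : is_pullback f (arr d) (arr b) t), t \oc k = s ->
  DistPullback hP = DistPullback hQ)) => u hu.
rewrite comp_idr => us; subst u.
by rewrite (Prop_irrelevance hu hP).
Qed.

Section Semicomplete.
Hypothesis sc : semicomplete.

Definition dpb x y (f : hom x y) (d : sub y) : dist_pullback f d :=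
  projT1 (cid (dist_pullback_ex sc f d)).

(* f^* *)
Definition iimage x y (f : hom x y) (d : sub y) : sub x := dpb_sub (dpb f d).

(* Span c f, with c : a -> x distinguished and f : a -> y, stands for the
   morphism f c^dagger from x to y. *)
Record span (x y : C) := Span {
  span_left : sub x;
  span_right : hom (dom span_left) y
}.

Lemma span_eq x y (c d : sub x) (f : hom (dom c) y) (g : hom (dom d) y)
    (h : hom (dom c) (dom d)) (k : hom (dom d) (dom c)) :
  arr c = arr d \oc h -> arr d = arr c \oc k -> f = g \oc h ->
  Span f = Span g.
Proof.
move=> eh ek; move: g.
apply: (sub_iso_ind eh ek (P := fun d h => forall g : hom (dom d) y,
  f = g \oc h -> Span f = Span g)) => g.
by rewrite comp_idr => ->.
Qed.

Definition sub_comp x (c : sub x) (d : sub (dom c)) : sub x :=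
  DistSub (dist_comp (arrP c) (arrP d)).

Definition span_id x : span x x := @Span x x (DistSub (dist_id T x)) (idm x).

Definition span_comp x y z (t : span y z) (s : span x y) : span x z :=
  let P := dpb (span_right s) (span_left t) in
  @Span x z (sub_comp (dpb_sub P)) (span_right t \oc dpb_top P).

Fact span_compA x y z w (u : span z w) (t : span y z) (s : span x y) :
  span_comp u (span_comp t s) = span_comp (span_comp u t) s.
Proof.
case: s t u => [c f] [d g] [e h]; rewrite /span_comp /=.
case: (dpb f d) => [d' f' /= [P PU]].
case: (dpb (g \oc f') e) => [e' q /= [Q QU]].
case: (dpb g e) => [e2 g2 /= [P2 P2U]].
case: (dpb f _) => [d2 f2 /= [Q2 Q2U]].
have [|k [[k1 k2] _]] := P2U _ (f' \oc arr e') q; first by rewrite comp_assoc.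
have [|m [[m1 m2] _]] := Q2U _ (arr d' \oc arr e') k.
  by rewrite -comp_assoc k1 !comp_assoc P.
have [|n [[n1 n2] _]] := PU _ (arr d2) (arr e2 \oc f2).
  by rewrite Q2 comp_assoc.
have [|l [[l1 l2] _]] := QU _ n (g2 \oc f2).
  by rewrite -comp_assoc n2 !comp_assoc P2.
apply: (@span_eq _ _ (sub_comp (c := sub_comp d') e') (sub_comp d2) _ _ m l) => /=.
- by rewrite -!comp_assoc m1.
- by rewrite -!comp_assoc l1 n1.
- by rewrite -!comp_assoc m2 k2.
Qed.

Fact span_comp1s x y (s : span x y) : span_comp (span_id y) s = s.
Proof.
case: s => [c f]; rewrite /span_comp /=.
case: (dpb f _) => [d' f' /= [P PU]].
have [|k [[k1 k2] _]] := PU _ (idm _) f; first by rewrite comp_idl comp_idr.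
apply: (@span_eq _ _ (sub_comp d') c _ _ (arr d') k) => //=.
by rewrite -comp_assoc k1 comp_idr.
Qed.

Fact span_comps1 x y (s : span x y) : span_comp s (span_id x) = s.
Proof.
case: s => [c f]; rewrite /span_comp /=.
case: (dpb (idm x) _) => [d' f' /= [P PU]].
have [|k [[k1 k2] _]] := PU _ (arr c) (idm _); first by rewrite comp_idl comp_idr.
apply: (@span_eq _ _ (sub_comp (c := DistSub (dist_id T x)) d') c _ _ f' k) => //=.
by rewrite -comp_assoc k1 comp_idl.
Qed.

Definition span_category : category :=
  Category span_compA span_comp1s span_comps1.

End Semicomplete.

Definition stable := semicomplete /\
  forall x y (s : hom x y) (d : sub y) p (p1 : hom p x) (p2 : hom p (dom d)),
    is_pullback s (arr d) p1 p2 ->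
    minus_class (@dist _ T) s -> minus_class (@dist _ T) p2.

End Sub.

Section Lattice.
Context {d : Order.disp_t}.
Implicit Type L : porderType d.

Record lattice_ops L := LatticeOps {
  lmeet : L -> L -> L;
  ljoin : L -> L -> L;
  lmeetP : forall a b, infimums [set a; b] (lmeet a b);
  ljoinP : forall a b, supremums [set a; b] (ljoin a b)
}.

Definition is_lattice L := inhabited (lattice_ops L).

Record boolean_ops L := BooleanOps {
  blattice :> lattice_ops L;
  bbot : L;
  btop : L;
  bcompl : L -> L;
  bbotP : forall a, (bbot <= a)%O;
  btopP : forall a, (a <= btop)%O;
  bdistr : left_distributive (lmeet blattice) (ljoin blattice);
  bmeetC : forall a, lmeet blattice a (bcompl a) = bbot;
  bjoinC : forall a, ljoin blattice a (bcompl a) = btop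
}.

Definition is_boolean_lattice L := inhabited (boolean_ops L).

End Lattice.

Section Conditions.
Variables (C : category) (T : thin_powered C).

Definition locally_finite := forall r, finite_set [set: sub T r].

Definition boolean :=
  semicomplete T /\ forall r, is_boolean_lattice (sub T r).

Record coherent : Prop := Coherent {
  coherent_stable : stable T;
  coherent_lattice : forall r, is_lattice (sub T r);
  coherent_join : forall x y (f : @hom C x y) (a b c : sub T y),
    supremums [set a; b] c ->
    supremums [set iimage coherent_stable.1 f a; iimage coherent_stable.1 f b]
      (iimage coherent_stable.1 f c);
  coherent_bot : forall x y (f : @hom C x y) (z : sub T y),
    lbound [set: sub T y] z ->
    lbound [set: sub T x] (iimage coherent_stable.1 f z)
}.

End Conditions.

Record cubicalizable := Cubicalizable {
  cub_cat :> category;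
  cub_zero : cub_cat;
  cub_init : forall r, hom cub_zero r;
  cub_init_uniq : forall r (f : hom cub_zero r), f = cub_init r;
  cub_thin : thin_powered cub_cat;
  cub_locally_finite : locally_finite cub_thin;
  cub_coherent : coherent cub_thin;
  cub_boolean : boolean cub_thin;
  cub_init_dist : forall r, dist cub_thin (cub_init r)
}.

Section Slice.
Variables (R : cubicalizable) (r : R).
Local Notation S := (sub (cub_thin R) r).
Import Order.Theory.

Definition slice_ops : boolean_ops S :=
  inhabited_witness ((cub_boolean R).2 r).

Fact slice_meetP (x y z : S) :
  (x <= lmeet slice_ops y z)%O = (x <= y)%O && (x <= z)%O.
Proof.
have [lb glb] := lmeetP slice_ops y z.
apply/idP/andP => [le|[xy xz]].
  by split; apply: le_trans le _; apply: lb; [left|right].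
by apply: glb => w [->|->].
Qed.

Fact slice_joinP (x y z : S) :
  (ljoin slice_ops x y <= z)%O = (x <= z)%O && (y <= z)%O.
Proof.
have [ub lub] := ljoinP slice_ops x y.
apply/idP/andP => [le|[xz yz]].
  by split; apply: le_trans _ le; apply: ub; [left|right].
by apply: lub => w [->|->].
Qed.

HB.instance Definition _ := Order.POrder_MeetJoin_isLattice.Build sub_display S
  slice_meetP slice_joinP.
HB.instance Definition _ :=
  Order.hasBottom.Build sub_display S (bbotP slice_ops).
HB.instance Definition _ :=
  Order.hasTop.Build sub_display S (btopP slice_ops).
HB.instance Definition _ :=
  Order.Lattice_Meet_isDistrLattice.Build sub_display S (bdistr slice_ops).
HB.instance Definition _ :=
  Order.TBDistrLattice_hasComplement.Build sub_display S
    (bjoinC slice_ops) (bmeetC slice_ops).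

End Slice.

(* The join semilattice L regarded as a monoid: product `|`, unit \bot. *)
Definition join_monoid d (L : bJoinSemilatticeType d) : Type := L.

Section JoinMonoid.
Context {d : Order.disp_t}.
Variable L : bJoinSemilatticeType d.
Import Order.Theory.

HB.instance Definition _ := Choice.on (join_monoid L).
HB.instance Definition _ := isMonoid.Build (join_monoid L)
  (@joinA d L) (@join0x d L) (@joinx0 d L).

End JoinMonoid.

Definition Endo (J : category) (j : J) : Type := hom j j.

Section Endo.
Variables (J : category) (j : J).

HB.instance Definition _ := gen_eqMixin (Endo j).
HB.instance Definition _ := gen_choiceMixin (Endo j).
HB.instance Definition _ := isMonoid.Build (Endo j)
  (@comp_assoc J j j j j) (@comp_idl J j j) (@comp_idr J j j).

End Endo.

(* The functor to monoids is given unbundled: M on objects, act on morphisms;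
   being functorial and monoid-valued is part of the property, as is being a
   monoid morphism for every mu j. *)
Record crossed_module (J : category) (M : J -> monoidType)
    (act : forall j k : J, hom j k -> M j -> M k)
    (mu : forall j : J, M j -> Endo j) : Prop := CrossedModule {
  act_morphism : forall j k (f : hom j k), monoid_morphism (act j k f);
  act_id : forall j a, act j j (idm j) a = a;
  act_comp : forall j k l (g : hom k l) (f : hom j k) a,
    act j l (g \oc f) a = act k l g (act j k f a);
  mu_morphism : forall j, monoid_morphism (mu j);
  crossed_CM1 : forall j k (f : hom j k) (a : M j),
    mu k (act j k f a) \oc f \oc mu j a = (mu k (act j k f a) ^+ 2)%g \oc f;
  crossed_CM2 : forall j (a b : M j),
    (a * b = act j j (mu j a) b * a)%g
}.

Definition cub_semicomplete (R : cubicalizable) : semicomplete (cub_thin R) :=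
  (cub_boolean R).1.
Arguments cub_semicomplete : clear implicits.

Section Complement.
Variable R : cubicalizable.

Definition Vcat : category := span_category (cub_semicomplete R).

Definition slice_monoid (r : Vcat) : monoidType := join_monoid (sub (cub_thin R) r).

Definition slice_act (x y : Vcat) (u : hom x y) (d : slice_monoid x) :
    slice_monoid y :=
  dimage (span_right u) (iimage (cub_semicomplete R) (arr (span_left u)) d).

(* xi |-> (~ xi) (~ xi)^dagger *)
Definition Lambda_compl (r : Vcat) (xi : slice_monoid r) : Endo r :=
  @Span _ (cub_thin R) r r (~` (xi : sub (cub_thin R) r))%O
    (arr (~` (xi : sub (cub_thin R) r))%O).

End Complement.

(* Main.v *)
From mathcomp Require Import all_boot all_order.
From mathcomp Require Import boolp classical_sets.
Require Import Defs.

Set Implicit Arguments.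
Unset Strict Implicit.
Unset Printing Implicit Defensive.

Import Order.Theory.
Local Open Scope order_scope.

(** A span acts on distinguished subobjects by pulling back along its left leg
    and then taking the image along its right leg, and [\Lambda^\complement]
    sends [xi] to the partial identity [zeta zeta^dagger] on the complement
    [zeta] of [xi].

    Image and inverse image are adjoint: both [f_* a <= b] and [a <= f^* b] say
    that [f] restricted to [a] factors through [b] ([dimage_adj]).  Hence [f_*]
    preserves finite joins; [f^*] preserves them by coherence, and so spans act
    by monoid morphisms.  Functoriality of the action comes down to the
    Beck-Chevalley identity for the pullback square that defines the composite
    of two spans; this is where stability of R^- is used ([beck_chevalley]).

    The partial identities compose like meets ([partial_id_comp]), so by De
    Morgan complementation turns joins into composites.  A span absorbs a partial
    identity on the right as soon as its left leg lies below the corresponding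
    subobject ([span_absorb]).  For [f gamma^dagger] and [b = gamma^* a], the left
    leg of the composite with the partial identity on [~` f_* b] is [gamma]
    restricted to [f^* (~` f_* b)].  Inverse images preserve complements and
    [b <= f^* (f_* b)], so [f^* (~` f_* b)] lies below [~` b = gamma^* (~` a)]:
    restricting further to [~` a] changes nothing, which is (CM1).  Finally the action of the
    partial identity on [zeta] is the meet with [zeta] ([dimage_iimage_arr]), and
    (CM2) becomes [a `|` b = (~` a `&` b) `|` a]. *)

(** * Distinguished subobjects, images and inverse images *)

Section ThinPowered.
Variables (C : category) (T : thin_powered C).
Implicit Types x y z : C.

(** The R^- part of [e] lifts against [d \oc e], which forces it to be an
    isomorphism between the subobjects given by [d \oc e] and by [d] composed
    with the image of [e]; such an isomorphism is an identity. *)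
Lemma dist_cancel x y z (d : hom y z) (e : hom x y) :
  dist T d -> dist T (d \oc e) -> dist T e.
Proof.
move=> Dd Dde; have [[m i s Di Ds E] _] := dist_fact T e.
have [|k [_ dek]] := Ds _ _ _ Dde (idm x) (d \oc i).
  by rewrite comp_idr E comp_assoc.
have deE : d \oc e = (d \oc i) \oc s by rewrite E comp_assoc.
have Ddi := dist_comp Dd Di.
suff iso_dist t : d \oc e = (d \oc i) \oc t -> dist T (i \oc t).
  by rewrite E; apply: iso_dist.
apply: (sub_iso_ind (d1 := DistSub Ddi) (d2 := DistSub Dde) (h := k) (k := s)
  (esym dek) deE (P := fun c _ => forall t : hom (dom c) m,
  arr c = (d \oc i) \oc t -> dist T (i \oc t))) => {}t /= di_t.
suff <- : idm m = t by rewrite comp_idr.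
by apply: (dist_monic Ddi); rewrite comp_idr.
Qed.

Lemma sub_le_factorP r (a b : sub T r) :
  reflect (exists e, arr a = arr b \oc e) (a <= b).
Proof.
apply: (iffP (sub_leP a b)) => [[e [_ ae]]|[e ae]]; first by exists e.
exists e; split=> //; apply: (dist_cancel (arrP b)).
by rewrite -ae; apply: arrP.
Qed.

Lemma le_ext r (a b : sub T r) : (forall c, (c <= a) = (c <= b)) -> a = b.
Proof. by move=> E; apply/le_anti; rewrite -E lexx E lexx. Qed.

Lemma ge_ext r (a b : sub T r) : (forall c, (a <= c) = (b <= c)) -> a = b.
Proof. by move=> E; apply/le_anti; rewrite E lexx -E lexx. Qed.

Lemma im_leP x y (f : hom x y) (b : sub T y) :
  reflect (exists t, f = arr b \oc t) (im T f <= b).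
Proof.
rewrite /im; case: (im_fact T f) => [m i s Di Ds E] /=.
apply: (iffP (sub_le_factorP _ _)) => /= [[e ie]|[t ft]].
  by exists (e \oc s); rewrite comp_assoc -ie.
have [|e [_ be]] := Ds _ _ _ (arrP b) t i; first by rewrite -E.
by exists e.
Qed.

(** Because [s] lifts against [c], precomposing with [s] does not hide any of
    [b]: the image of [arr b \oc s] is still [b]. *)
Lemma minus_factor x y (b c : sub T y) (s : hom x (dom b)) t :
  minus_class (@dist _ T) s -> arr b \oc s = arr c \oc t -> b <= c.
Proof.
move=> Ms bs; have [|e [_ ce]] := Ms _ _ _ (arrP c) t (arr b).
  by rewrite -bs.
by apply/sub_le_factorP; exists e.
Qed.

Lemma dimage_id r (a : sub T r) : dimage (idm r) a = a.
Proof.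
apply: ge_ext => c; rewrite /dimage comp_idl.
exact/im_leP/sub_le_factorP.
Qed.

Section InverseImage.
Hypothesis sc : semicomplete T.

Lemma dist_pullback_lift x y (f : hom x y) (b : sub T y) (P : dist_pullback f b)
    z (h : hom z x) (t : hom z (dom b)) :
  f \oc h = arr b \oc t -> exists s, h = arr (dpb_sub P) \oc s.
Proof. by move=> fh; have [s [[hs _] _]] := (dpbP P).2 _ _ _ fh; exists s. Qed.

Lemma iimageE x y (f : hom x y) (b : sub T y) :
  f \oc arr (iimage sc f b) = arr b \oc dpb_top (dpb sc f b).
Proof. exact: (dpbP _).1. Qed.

Lemma iimage_leP x y (f : hom x y) (a : sub T x) (b : sub T y) :
  reflect (exists t, f \oc arr a = arr b \oc t) (a <= iimage sc f b).
Proof.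
apply: (iffP (sub_le_factorP _ _)) => [[s ->]|[t ft]].
  by rewrite comp_assoc iimageE -comp_assoc; eexists.
exact: dist_pullback_lift ft.
Qed.

(** Both sides say that [f] restricted to [a] factors through [b]. *)
Lemma dimage_adj x y (f : hom x y) (a : sub T x) (b : sub T y) :
  (dimage f a <= b) = (a <= iimage sc f b).
Proof. exact/im_leP/iimage_leP. Qed.

Lemma iimage_comp x y z (g : hom y z) (f : hom x y) (c : sub T z) :
  iimage sc (g \oc f) c = iimage sc f (iimage sc g c).
Proof.
apply: le_ext => a; apply/iimage_leP/iimage_leP => -[t gfa].
  by apply: (@dist_pullback_lift _ _ _ _ _ _ _ t); rewrite comp_assoc.
by rewrite -comp_assoc gfa comp_assoc iimageE -comp_assoc; eexists.
Qed.

Lemma dimage_comp x y z (g : hom y z) (f : hom x y) (a : sub T x) :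
  dimage (g \oc f) a = dimage g (dimage f a).
Proof. by apply: ge_ext => c; rewrite !dimage_adj iimage_comp. Qed.

Lemma dimage_mono x y (f : hom x y) (a b : sub T x) :
  a <= b -> dimage f a <= dimage f b.
Proof. by move=> ab; rewrite dimage_adj (le_trans ab) // -dimage_adj. Qed.

Lemma dimage_arr_le r (b : sub T r) (a : sub T (dom b)) : dimage (arr b) a <= b.
Proof. by apply/im_leP; exists (arr a). Qed.

Lemma dimage_arr r (b : sub T r) (a : sub T (dom b)) :
  dimage (arr b) a = sub_comp a.
Proof. by apply: ge_ext => c; apply/im_leP/sub_le_factorP. Qed.

(** A pullback of two distinguished injections is their intersection.  As the
    slices are only posets here, this is said through lower bounds. *)
Lemma sub_comp_iimageP r (a b c : sub T r) :
  (c <= sub_comp (iimage sc (arr b) a)) = (c <= a) && (c <= b).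
Proof.
rewrite -dimage_arr; apply/idP/andP => [h|[]].
  split; apply: le_trans h _; last exact: dimage_arr_le.
  by rewrite dimage_adj.
rewrite dimage_arr => /sub_le_factorP[s cs] /sub_le_factorP[t ct].
apply/sub_le_factorP.
have [u tu] := dist_pullback_lift (dpb sc (arr b) a) (etrans (esym ct) cs).
by exists u; rewrite /= -comp_assoc -tu.
Qed.

(** Factor [f \oc arr a] as [i \oc s] with [i] its image and [s] in R^-.
    Pulling [s] back to the intersection of [i] with [d] stays in R^- by
    stability, so that intersection is the image of the part of [a] which [f]
    sends into [d]. *)
Lemma beck_chevalley (st : stable T) x y (f : hom x y) (d : sub T y)
    (P : dist_pullback f d) (a : sub T x) :
  dimage (dpb_top P) (iimage sc (arr (dpb_sub P)) a) =
  iimage sc (arr d) (dimage f a).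
Proof.
have PE : f \oc arr (dpb_sub P) = arr d \oc dpb_top P := (dpbP P).1.
apply/le_anti/andP; split.
  rewrite -dimage_adj -dimage_comp -PE dimage_comp; apply: dimage_mono.
  by rewrite dimage_adj.
set E := dimage (dpb_top P) _; rewrite /dimage /im.
case: (im_fact T (f \oc arr a)) => [m i s Di Ms fa] /=.
set j := iimage sc (arr d) _.
(* [t] includes the intersection of [i] and [d] into [i]. *)
have [t it] : exists t, arr d \oc arr j = i \oc t.
  exact/(iimage_leP (arr d) j (DistSub Di))/lexx.
have Dt : dist T t.
  by apply: (dist_cancel Di); rewrite -it; apply: dist_comp (arrP d) (arrP j).
(* [b] is the part of [a] which [f] sends into [d], and [s'] in R^- maps it
   onto the intersection [j]. *)
have [b s' bs'] := dpb sc s (DistSub Dt).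
have Ms' := st.2 _ _ _ _ _ _ _ bs' Ms; have {bs'} [/= sb _] := bs'.
have fab : f \oc (arr a \oc arr b) = arr d \oc (arr j \oc s').
  by rewrite !comp_assoc fa it -!comp_assoc sb.
(* As [f] maps [b] into [d], it lies in the pullback of [d]; being also in [a],
   it lies in the subobject whose image is [E]. *)
have [c abc] := dist_pullback_lift P fab.
have js' : dpb_top P \oc c = arr j \oc s'.
  by apply: (dist_monic (arrP d)); rewrite comp_assoc -PE -comp_assoc -abc fab.
have [u cu] := dist_pullback_lift (dpb sc (arr (dpb_sub P)) a) (esym abc).
have [v Ev] : exists v,
    dpb_top P \oc arr (iimage sc (arr (dpb_sub P)) a) = arr E \oc v.
  exact/im_leP/lexx.
apply: (@minus_factor _ _ j E s' (v \oc u) Ms').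
by rewrite -js' cu comp_assoc Ev -comp_assoc.
Qed.

(** * Spans and partial identities *)

Definition span_act x y (s : span T x y) (a : sub T x) : sub T y :=
  dimage (span_right s) (iimage sc (arr (span_left s)) a).

Lemma span_act_id r (a : sub T r) : span_act (span_id T r) a = a.
Proof.
rewrite /span_act /= dimage_id; apply: le_ext => c.
by rewrite -dimage_adj dimage_id.
Qed.

Lemma span_act_comp (st : stable T) x y z (t : span T y z) (s : span T x y) a :
  span_act (span_comp sc t s) a = span_act t (span_act s a).
Proof. by rewrite /span_act /= dimage_comp iimage_comp beck_chevalley. Qed.

Definition partial_id r (a : sub T r) : span T r r := Span (arr a).

(** Since [arr a] is monic and the left leg factors through it, the pullback
    that computes the composite has the domain of the left leg as its apex and
    the identity as its projection to it. *)
Lemma span_absorb x y (s : span T x y) (a : sub T x) :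
  span_left s <= a -> span_comp sc s (partial_id a) = s.
Proof.
case: s => [c f] /= /sub_le_factorP[e ce]; rewrite /span_comp /=.
case: (dpb sc (arr a) c) => [d t /= [E U]].
have [k [[de tk] _]] := U _ e (idm _) (etrans (esym ce) (esym (comp_idr _))).
apply: (@span_eq _ _ _ _ (sub_comp d) c _ _ t k) => //=.
by rewrite -comp_assoc de.
Qed.

(** The composite is computed by the pullback of [a] and [b], whose two maps to
    [r] agree: both legs of the span are the intersection of [a] and [b]. *)
Lemma partial_id_comp r (a b c : sub T r) :
  (forall d, (d <= c) = (d <= a) && (d <= b)) ->
  span_comp sc (partial_id a) (partial_id b) = partial_id c.
Proof.
move=> cP; have -> : c = sub_comp (iimage sc (arr b) a).
  by apply: le_ext => d; rewrite cP sub_comp_iimageP.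
rewrite /span_comp /partial_id /=; congr Span.
exact: esym (dpbP _).1.
Qed.

Lemma span_left_partial_id_comp x y (s : span T x y) (b : sub T y) :
  span_left (span_comp sc (partial_id b) s) =
  sub_comp (iimage sc (span_right s) b).
Proof. by []. Qed.

End InverseImage.
End ThinPowered.

(** * Boolean slices and the crossed module *)

Section Cubicalizable.
Variable R : cubicalizable.
Implicit Types x y r : R.
Local Notation T := (cub_thin R).
Local Notation sc := (cub_semicomplete R).
Local Notation "f ^*" := (iimage sc f) : order_scope.

Lemma supremums_join r (a b : sub T r) : supremums [set a; b]%classic (a `|` b).
Proof.
split=> [c [->|->]|c ub]; rewrite ?leUl ?leUr //.
by rewrite leUx !ub //; [right|left].
Qed.

Lemma iimage_join x y (f : hom x y) (a b : sub T y) :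
  f^* (a `|` b) = f^* a `|` f^* b.
Proof.
have := coherent_join (cub_coherent R) f (supremums_join a b).
(* Inverse images depend on a proof of semicompleteness, and coherence comes
   with its own. *)
rewrite (Prop_irrelevance (coherent_stable (cub_coherent R)).1 sc) => -[ub lub].
apply/le_anti; rewrite leUx !ub ?andbT; [|by right|by left].
by apply: lub => c [->|->]; rewrite ?leUl ?leUr.
Qed.

Lemma iimage_bot x y (f : hom x y) : f^* \bot = \bot :> sub T x.
Proof.
have := @coherent_bot _ _ (cub_coherent R) _ _ f \bot (fun _ _ => le0x _).
rewrite (Prop_irrelevance (coherent_stable (cub_coherent R)).1 sc) => lb.
by apply/eqP; rewrite -lex0; apply: lb.
Qed.

Lemma iimage_meet x y (f : hom x y) (a b : sub T y) :
  f^* (a `&` b) = f^* a `&` f^* b.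
Proof. by apply: le_ext => c; rewrite lexI -!dimage_adj lexI. Qed.

Lemma iimage_top x y (f : hom x y) : f^* \top = \top :> sub T x.
Proof. by apply/eqP; rewrite -le1x -dimage_adj lex1. Qed.

Lemma iimage_compl x y (f : hom x y) (a : sub T y) : f^* (~` a) = ~` f^* a.
Proof.
apply/le_anti; rewrite -disj_leC -iimage_meet meetCx iimage_bot eqxx /=.
rewrite -[leRHS]complK -disj_leC -complU -iimage_join.
by rewrite joinxC iimage_top compl1.
Qed.

Lemma dimage_join x y (f : hom x y) (a b : sub T x) :
  dimage f (a `|` b) = dimage f a `|` dimage f b.
Proof. by apply: ge_ext => c; rewrite (dimage_adj sc) !leUx !(dimage_adj sc). Qed.

Lemma dimage_bot x y (f : hom x y) : dimage f \bot = \bot :> sub T y.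
Proof. by apply/eqP; rewrite -lex0 (dimage_adj sc) le0x. Qed.

Lemma dimage_iimage_arr r (a b : sub T r) : dimage (arr b) ((arr b)^* a) = a `&` b.
Proof. by apply: le_ext => c; rewrite dimage_arr sub_comp_iimageP lexI. Qed.

Lemma partial_id_top r : partial_id (\top : sub T r) = span_id T r.
Proof.
have -> : \top = DistSub (dist_id T r) :> sub T r.
  apply/eqP; rewrite eq_sym -le1x; apply/sub_le_factorP.
  by exists (arr \top); rewrite comp_idl.
by [].
Qed.

End Cubicalizable.

Theorem proposition7p9 (R : cubicalizable) :
  crossed_module (@slice_act R) (@Lambda_compl R).
Proof.
have st := coherent_stable (cub_coherent R).
have mu_M r : monoid_morphism (@Lambda_compl R r).
  split=> [|a b].
    by rewrite /Lambda_compl /= -[RHS]partial_id_top -compl0.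
  apply/esym; apply: partial_id_comp => c.
  by rewrite -lexI -complU.
split=> //.
- move=> x y s; split=> [|a b]; rewrite /slice_act /=.
    by rewrite -[1%g]/(\bot : sub _ _) iimage_bot dimage_bot.
  by rewrite -[(a * b)%g]/((a : sub _ _) `|` b) iimage_join dimage_join.
- by move=> r a; apply: span_act_id.
- by move=> x y z t s a; apply: span_act_comp.
- move=> x y s a.
  have -> :
      (Lambda_compl (slice_act s a) ^+ 2 = Lambda_compl (slice_act s a))%g.
    by rewrite expg2 -(mu_M y).2; congr Lambda_compl; apply: joinxx.
  (* What remains is that [a] can be dropped on the right; by adjunction its
     condition becomes [b <= f^* (f_* b)] for [b = gamma^* a]. *)
  apply: span_absorb; rewrite span_left_partial_id_comp -dimage_arr.
  by rewrite (dimage_adj (cub_semicomplete R)) !iimage_compl leC -dimage_adj.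
- move=> r a b.
  rewrite /slice_act /= dimage_iimage_arr.
  rewrite -[LHS]/((a : sub _ _) `|` b).
  rewrite -[RHS]/(((b : sub _ _) `&` ~` (a : sub _ _)) `|` a).
  by rewrite joinIl [X in _ `&` X]joinC joinxC meetx1 joinC.
Qed.
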